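(* Let $\Lambda$ be a hyperbolic set for a $C^r$ diffeomorphism $f$ ($r\ge1$) of a compact Riemannian manifold, with bracket $[\cdot,\cdot]$ defined at scale $\delta_0$. For $x,y\in\Lambda$ with $d(x,y)<\delta_0$, $$d([x,y],x)\le C_1\,d(x,y),\qquad d([x,y],y)\le C_1\,d(x,y),$$ where $C_1=(1-K)^{-1}$ and $K$ is the Lipschitz constant of the manifold graphs.
   Context: A compact set $\Lambda\subset M$ with $f(\Lambda)=\Lambda$ is hyperbolic if there is a continuous $Df$-invariant splitting $T_\Lambda M=E^s\oplus E^u$ and constants $c>0$, $\lambda\in(0,1)$ such that for all $x\in\Lambda$, $n\ge0$: $\|Df^n_x v\|\le c\lambda^n\|v\|$ for $v\in E^s_x$ and $\|Df^{-n}_x v\|\le c\lambda^n\|v\|$ for $v\in E^u_x$. An adapted metric (one in which these hold with $c=1$) is used. $W^s_\varepsilon(x)=\{y\in M: d(f^n(x),f^n(y))\le\varepsilon\ \forall n\ge0\}$, $W^u_\varepsilon(x)=\{y\in M: d(f^{-n}(x),f^{-n}(y))\le\varepsilon\ \forall n\ge0\}$. Constants $\varepsilon_0,\delta_0>0$ are fixed so that for $x,y\in\Lambda$ with $d(x,y)<\delta_0$ the set $W^s_{\varepsilon_0}(x)\cap W^u_{\varepsilon_0}(y)$ is exactly one point, belonging to $\Lambda$ and denoted $[x,y]$. In local (exponential) coordinates near a point $z\in\Lambda$ close to $x$ and $y$, with $T_zM=E^s_z\oplus E^u_z$ and norm $\|(s,u)\|=\max\{\|s\|,\|u\|\}$,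 $W^s_{\varepsilon_0}(x)$ is the graph of a function $\phi_x:E^s_z\to E^u_z$ and $W^u_{\varepsilon_0}(y)$ is the graph of a function $\psi_y:E^u_z\to E^s_z$; $\varepsilon_0$ and $\delta_0$ are chosen so small that all these functions are Lipschitz with constant at most $K<1/2$.
   Formalization: In the two inequalities d is the max-norm distance in exponential coordinates at any z in Λ within δ_0 of x and y; with the Riemannian distance the bound fails, e.g. for a linear Anosov torus map with a flat metric making a small angle between E^s and E^u. *)

(* Defs.v *)
From HB Require Import structures.
From mathcomp Require Import all_boot all_order all_algebra.
From mathcomp Require Import all_classical all_reals all_analysis.

Set Implicit Arguments.
Unset Strict Implicit.
Unset Printing Implicit Defensive.

Import Order.TTheory GRing.Theory Num.Theory.
Import numFieldNormedType.Exports.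

Local Open Scope classical_set_scope.
Local Open Scope ring_scope.

(** For an open set U of a finite-dimensional space, the existence and
    continuity on U of all iterated directional derivatives of order r is
    equivalent to being of class C^r in the sense of Frechet derivatives; it
    entails the continuity of the derivatives of lower order. *)
Fixpoint Cr_on (R : realType) (V W : normedModType R) (r : nat)
    (U : set V) (F : V -> W) : Prop :=
  if r is r'.+1 then
    forall v : V, (forall x, U x -> derivable F x v) /\ Cr_on r' U ('D_v F)
  else forall x, U x -> {for x, continuous F}.

Record chart (R : realType) (n : nat) (M : topologicalType) := Chart {
  csrc : set M;
  cfun :> M -> 'rV[R]_n;
  cinv : 'rV[R]_n -> M;
  csrc_open : open csrc;
  ctgt_open : open (cfun @` csrc);
  cfunK : forall x, csrc x -> cinv (cfun x) = x;
  cfun_continuous : forall x, csrc x -> {for x, continuous cfun};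
  cinv_continuous : forall u, (cfun @` csrc) u -> {for u, continuous cinv}
}.

(** A C^oo atlas, with a preferred chart [chart_at x] around each point x.  The
    tangent space T_x M is 'rV[R]_n, a tangent vector at x being given by its
    components in [chart_at x]. *)
Record smooth_manifold (R : realType) (n : nat) (M : topologicalType) :=
  SmoothManifold {
  atlas : set (chart R n M);
  chart_at : M -> chart R n M;
  chart_at_atlas : forall x, atlas (chart_at x);
  chart_at_src : forall x, csrc (chart_at x) x;
  atlas_compat : forall c c', atlas c -> atlas c' ->
    forall r, Cr_on r (c @` (csrc c `&` csrc c')) (c' \o cinv c)
}.

Section Manifold.
Variables (R : realType) (n : nat) (M : topologicalType).
Variable X : smooth_manifold R n M.
Implicit Types (x y z p q : M) (u v w : 'rV[R]_n).

Definition Cr_map (r : nat) (f : M -> M) : Prop :=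
  continuous f /\
  forall c c', atlas X c -> atlas X c' ->
    Cr_on r (c @` (csrc c `&` f @^-1` csrc c')) (c' \o f \o cinv c).

Definition Cr_diffeo (r : nat) (f finv : M -> M) : Prop :=
  [/\ cancel f finv, cancel finv f, Cr_map r f & Cr_map r finv].

Definition tangent_map (f : M -> M) x : 'rV[R]_n -> 'rV[R]_n :=
  'd (chart_at X (f x) \o f \o cinv (chart_at X x)) (chart_at X x x).

(** Components in the chart [c] of the tangent vector v at x. *)
Definition tangent_in (c : chart R n M) x v : 'rV[R]_n :=
  'd (c \o cinv (chart_at X x)) (chart_at X x x) v.

(** The tangent vector at [cinv c u] whose components in the chart [c] are v. *)
Definition tangent_out (c : chart R n M) u v : 'rV[R]_n :=
  'd (chart_at X (cinv c u) \o cinv c) u v.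

Definition Cr_curve (r : nat) (gamma : R -> M) : Prop :=
  continuous (gamma : R^o -> M) /\
  forall c, atlas X c ->
    Cr_on r ((gamma @^-1` csrc c) : set R^o) (c \o gamma : R^o -> 'rV[R]_n).

Definition velocity (gamma : R -> M) (t : R) : 'rV[R]_n :=
  derive1 (chart_at X (gamma t) \o gamma) t.

Definition gram_in (G : M -> 'M[R]_n) (c : chart R n M) u : 'M[R]_n :=
  \matrix_(i, j) (tangent_out c u (delta_mx 0 i) *m G (cinv c u)
                    *m (tangent_out c u (delta_mx 0 j))^T) 0 0.

Record riemannian_metric := RiemannianMetric {
  gram : M -> 'M[R]_n;
  gram_sym : forall x, (gram x)^T = gram x;
  gram_pos : forall x v, v != 0 -> 0 < (v *m gram x *m v^T) 0 0;
  gram_smooth : forall c, atlas X c ->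
    forall r, Cr_on r (c @` csrc c) (gram_in gram c)
}.

Variable g : riemannian_metric.

Definition gnorm x v : R := Num.sqrt ((v *m gram g x *m v^T) 0 0).

Definition curve_length (gamma : R -> M) : \bar R :=
  (\int[lebesgue_measure]_(t in `[0%R, 1%R])
     (gnorm (gamma t) (velocity gamma t))%:E)%E.

(** The value is +oo when x and y are in different components.  Restricting to
    C^1 curves defined on the whole line is harmless: a piecewise C^1 curve on
    [0, 1] can be reparametrized, with the same length, so as to stop at its
    corners and endpoints. *)
Definition rdist x y : \bar R :=
  ereal_inf [set curve_length gamma | gamma in
    [set gamma | [/\ Cr_curve 1 gamma, gamma 0 = x & gamma 1 = y]]].

Definition christoffel (c : chart R n M) u (k i j : 'I_n) : R :=
  let G := gram_in (gram g) c in
  2^-1 * \sum_(l < n) invmx (G u) k l *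
    ('D_(delta_mx 0 i) (fun w => G w j l : R^o) u
     + 'D_(delta_mx 0 j) (fun w => G w i l : R^o) u
     - 'D_(delta_mx 0 l) (fun w => G w i j : R^o) u).

Definition geodesic (gamma : R -> M) : Prop :=
  Cr_curve 2 gamma /\
  forall c, atlas X c -> forall t, csrc c (gamma t) -> forall k : 'I_n,
    let q := c \o gamma in
    (derive1 (derive1 q) t) 0 k =
      - \sum_(i < n) \sum_(j < n)
          christoffel c (q t) k i j * (derive1 q t) 0 i * (derive1 q t) 0 j.

(** On a compact (hence complete) manifold exactly one y satisfies the
    condition; the default value z is never used. *)
Definition exp_map z v : M :=
  xget z [set y | exists gamma,
    [/\ geodesic gamma, gamma 0 = z, velocity gamma 0 = v & gamma 1 = y]].

Definition tball z (rho : R) : set 'rV[R]_n := [set v | gnorm z v < rho].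

(** The local coordinate map at z: the inverse of the exponential map on the
    ball of radius rho. *)
Definition log_map (rho : R) z p : 'rV[R]_n :=
  xget 0 [set v | tball z rho v /\ exp_map z v = p].

Definition continuous_subbundle (Lam : set M)
    (E : M -> {vspace 'rV[R]_n}) : Prop :=
  forall x, Lam x -> exists U : set M,
    [/\ open U, U x, U `<=` csrc (chart_at X x) &
     exists k (e : 'I_k -> M -> 'rV[R]_n),
       (forall i, {within Lam `&` U,
                   continuous (fun y => tangent_in (chart_at X x) y (e i y))})
       /\ (forall y, (Lam `&` U) y -> basis_of (E y) [tuple e i y | i < k])].

Definition invariant_subbundle (Lam : set M) (f : M -> M)
    (E : M -> {vspace 'rV[R]_n}) : Prop :=
  forall x, Lam x -> tangent_map f x @` [set` E x] = [set` E (f x)].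

(** [Lam] is a hyperbolic set with splitting [Es], [Eu] and constants [c] and
    [lam]; the metric [g] is adapted when this holds with c = 1. *)
Record hyperbolic (Lam : set M) (f finv : M -> M)
    (Es Eu : M -> {vspace 'rV[R]_n}) (c lam : R) : Prop := Hyperbolic {
  hyp_compact : compact Lam;
  hyp_inv : f @` Lam = Lam;
  hyp_c_gt0 : 0 < c;
  hyp_lam_gt0 : 0 < lam;
  hyp_lam_lt1 : lam < 1;
  hyp_sum : forall x, Lam x -> (Es x + Eu x = fullv)%VS;
  hyp_cap : forall x, Lam x -> (Es x :&: Eu x = 0)%VS;
  hyp_s_cont : continuous_subbundle Lam Es;
  hyp_u_cont : continuous_subbundle Lam Eu;
  hyp_s_inv : invariant_subbundle Lam f Es;
  hyp_u_inv : invariant_subbundle Lam f Eu;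
  hyp_s_contract : forall x, Lam x -> forall v, v \in Es x -> forall m : nat,
    gnorm (iter m f x) (tangent_map (iter m f) x v)
      <= c * lam ^+ m * gnorm x v;
  hyp_u_contract : forall x, Lam x -> forall v, v \in Eu x -> forall m : nat,
    gnorm (iter m finv x) (tangent_map (iter m finv) x v)
      <= c * lam ^+ m * gnorm x v
}.

(** The local stable set of [f]; the local unstable set is that of the inverse
    of [f]. *)
Definition Wloc (f : M -> M) (eps : R) x : set M :=
  [set y | forall m : nat, (rdist (iter m f x) (iter m f y) <= eps%:E)%E].

Definition bracket (f finv : M -> M) (eps : R) x y : M :=
  xget x (Wloc f eps x `&` Wloc finv eps y).

(** The norm max(|s|, |u|) on T_z M = E (+) F. *)
Definition box_norm z (E F : {vspace 'rV[R]_n}) v : R :=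
  Num.max (gnorm z (daddv_pi E F v)) (gnorm z (daddv_pi F E v)).

(** In the exponential coordinates at z, the set S is the graph of a
    K-Lipschitz function phi : E -> F; since S is a local object, phi is only
    meant on a part D of E. *)
Definition lipschitz_graph (rho : R) z (E F : {vspace 'rV[R]_n}) (K : R)
    (S : set M) : Prop :=
  exists (D : set 'rV[R]_n) (phi : 'rV[R]_n -> 'rV[R]_n),
    [/\ forall s, D s -> s \in E,
        forall s, D s -> phi s \in F,
        forall s s', D s -> D s' ->
          gnorm z (phi s - phi s') <= K * gnorm z (s - s'),
        forall s, D s -> tball z rho (s + phi s)
      & S = [set exp_map z (s + phi s) | s in D]].

(** The distance read in the local coordinates at z.  The constant 1 / (1 - K)
    refers to this distance: already for a linear automorphism of a flat torus
    (where K = 0) it is not valid for [rdist] when Es and Eu make a small angle,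
    which an adapted metric does not exclude. *)
Definition coord_dist (rho : R) (Es Eu : M -> {vspace 'rV[R]_n}) z p q : R :=
  box_norm z (Es z) (Eu z) (log_map rho z p - log_map rho z q).

End Manifold.

(* Main.v *)
Require Import Defs.
From HB Require Import structures.
From mathcomp Require Import all_boot all_order all_algebra.
From mathcomp Require Import all_classical all_reals all_analysis.
From mathcomp Require Import lra.
(* A second time, so that [gnorm] is the norm of the Riemannian metric. *)
Require Import Defs.

Set Implicit Arguments.
Unset Strict Implicit.
Unset Printing Implicit Defensive.

Import Order.TTheory GRing.Theory Num.Theory.
Import numFieldNormedType.Exports.

Local Open Scope classical_set_scope.
Local Open Scope ring_scope.

(** Read everything in the exponential coordinates at z and split
    T_z M = E^s (+) E^u.  Write p for the bracket of x and y.

    The points p and x lie on the same stable manifold, the graph of a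
    K-Lipschitz map E^s -> E^u, so the unstable component of p - x is at most K
    times its stable component; symmetrically, the stable component of p - y is
    at most K times its unstable one ([lipschitz_graph_log]).  The point x
    itself lies on its stable manifold because the constant curve has length 0
    ([rdistxx_le0]).

    Put a = |(p - x)_s|, b = |(p - y)_u| and d = d(x, y) for the max norm.  Going
    from p to x through y, and from p to y through x,
      a <= |(p - y)_s| + |(x - y)_s| <= K b + d,
      b <= |(p - x)_u| + |(x - y)_u| <= K a + d.
    Substituting, (1 - K^2) a <= (1 + K) d, that is a <= d / (1 - K), and the
    same for b ([transverse_cone_bound]).  As K < 1, a is the max norm of p - x
    and b that of p - y.

    The triangle inequality applied to the components is that of the norm of
    the metric on T_z M ([ler_gnormD]). *)

Section TangentNorm.
Variables (R : realType) (n : nat) (M : topologicalType).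
Variables (X : smooth_manifold R n M) (g : riemannian_metric X).
Implicit Types (z : M) (u v w : 'rV[R]_n) (a b : R).

Definition inner z u v : R := (u *m gram g z *m v^T) 0 0.

Lemma innerC z u v : inner z u v = inner z v u.
Proof.
have uv : u *m gram g z *m v^T = (v *m gram g z *m u^T)^T.
  by rewrite !trmx_mul trmxK gram_sym mulmxA.
by rewrite /inner uv mxE.
Qed.

Lemma innerDl z u v w : inner z (u + v) w = inner z u w + inner z v w.
Proof. by rewrite /inner !mulmxDl mxE. Qed.

Lemma innerZl z a u v : inner z (a *: u) v = a * inner z u v.
Proof. by rewrite /inner -!scalemxAl mxE. Qed.

Lemma innerDr z u v w : inner z w (u + v) = inner z w u + inner z w v.
Proof. by rewrite innerC innerDl !(innerC z w). Qed.

Lemma innerZr z a u v : inner z u (a *: v) = a * inner z u v.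
Proof. by rewrite innerC innerZl innerC. Qed.

Lemma inner_ge0 z v : 0 <= inner z v v.
Proof.
have [->|v0] := eqVneq v 0; first by rewrite /inner !mul0mx mxE.
exact/ltW/gram_pos.
Qed.

Lemma gnorm_sqr z v : gnorm g z v ^+ 2 = inner z v v.
Proof. by rewrite sqr_sqrtr// inner_ge0. Qed.

Lemma gnorm_ge0 z v : 0 <= gnorm g z v.
Proof. exact: sqrtr_ge0. Qed.

Lemma gnorm_gt0 z v : v != 0 -> 0 < gnorm g z v.
Proof. by move=> v0; rewrite sqrtr_gt0 gram_pos. Qed.

Lemma gnorm0 z : gnorm g z 0 = 0.
Proof. by rewrite /gnorm !mul0mx mxE sqrtr0. Qed.

Lemma gnormN z v : gnorm g z (- v) = gnorm g z v.
Proof.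
congr Num.sqrt; rewrite -/(inner z _ _) -scaleN1r innerZl innerZr.
by rewrite mulrA mulrNN !mul1r.
Qed.

(** Cauchy-Schwarz: for nonzero u and v, the vector |v| u - |u| v has
    nonnegative square 2 |u| |v| (|u| |v| - <u, v>). *)
Lemma inner_le_gnorm z u v : inner z u v <= gnorm g z u * gnorm g z v.
Proof.
have [->|u0] := eqVneq u 0.
  by rewrite gnorm0 mul0r /inner !mul0mx mxE.
have [->|v0] := eqVneq v 0.
  by rewrite gnorm0 mulr0 innerC /inner !mul0mx mxE.
have := inner_ge0 z (gnorm g z v *: u + (- gnorm g z u) *: v).
rewrite !(innerDl, innerDr, innerZl, innerZr) (innerC z v u) -!gnorm_sqr.
move: (gnorm_gt0 z u0) (gnorm_gt0 z v0).
move: (gnorm g z u) (gnorm g z v) (inner z u v) => a b c a0 b0 h.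
rewrite -(ler_pM2l (mulr_gt0 a0 b0)); lra.
Qed.

Lemma ler_gnormD z u v : gnorm g z (u + v) <= gnorm g z u + gnorm g z v.
Proof.
rewrite -(ler_pXn2r (n := 2))// ?nnegrE ?addr_ge0 ?gnorm_ge0//.
rewrite gnorm_sqr !(innerDl, innerDr) (innerC z v u) -!gnorm_sqr.
by have := inner_le_gnorm z u v; lra.
Qed.

Lemma box_norm_projE z (E F : {vspace 'rV[R]_n}) v :
  gnorm g z (daddv_pi E F v) <= box_norm g z E F v.
Proof. by rewrite le_max lexx. Qed.

Lemma box_norm_projF z (E F : {vspace 'rV[R]_n}) v :
  gnorm g z (daddv_pi F E v) <= box_norm g z E F v.
Proof. by rewrite le_max lexx orbT. Qed.

End TangentNorm.

Lemma Cr_on_cst (R : realType) (V W : normedModType R) (r : nat) (U : set V)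
  (a : W) : Cr_on r U (cst a : V -> W).
Proof.
elim: r a => [|r IH] a /=; first by move=> x _; exact: cvg_cst.
move=> v; split=> [x _|]; first exact: derivable_cst.
suff -> : 'D_v (cst a : V -> W) = cst 0 by exact: IH.
by apply/funext => x; rewrite derive_cst.
Qed.

Section LocalSets.
Variables (R : realType) (n : nat) (M : topologicalType).
Variables (X : smooth_manifold R n M) (g : riemannian_metric X).

(** The constant curve has length 0; an upper bound is what membership in the
    local stable and unstable sets asks for. *)
Lemma rdistxx_le0 (x : M) : (rdist g x x <= 0)%E.
Proof.
apply: ereal_inf_lbound; exists (cst x).
  split=> //; split=> [t|c _]; first exact: cvg_cst.
  exact: (@Cr_on_cst R R^o 'rV[R]_n 1 _ (c x)).
apply: integral0_eq => t _.
rewrite /velocity (_ : _ \o _ = cst (chart_at X x x))// derive1_cst.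
by rewrite gnorm0.
Qed.

Lemma Wloc_refl (f : M -> M) (eps : R) (x : M) : 0 <= eps -> Wloc g f eps x x.
Proof. by move=> e0 m; rewrite (le_trans (rdistxx_le0 _)). Qed.

End LocalSets.

Section Coordinates.
Variables (R : realType) (n : nat) (M : topologicalType).
Variables (X : smooth_manifold R n M) (g : riemannian_metric X).
Variables (rho : R) (z : M).
Hypothesis exp_inj : {in tball g z rho &, injective (exp_map g z)}.

(** [log_map] is a choice among preimages; injectivity of the exponential map
    on the ball leaves only one. *)
Lemma exp_mapK v : tball g z rho v -> log_map g rho z (exp_map g z v) = v.
Proof.
move=> vB; apply: xget_unique => // w [wB wv].
by apply: exp_inj; rewrite ?inE.
Qed.

(** Two points s + phi s and t + phi t of a graph over E differ by
    (s - t) + (phi s - phi t); since the sum of E and F is direct, these terms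
    are the E- and F-components of the difference, so the Lipschitz condition
    is a cone condition on differences, free of the parametrization. *)
Lemma lipschitz_graph_log (E F : {vspace 'rV[R]_n}) K (S : set M) p q :
    (E :&: F = 0)%VS -> lipschitz_graph g rho z E F K S -> S p -> S q ->
  let v := log_map g rho z p - log_map g rho z q in
  gnorm g z (daddv_pi F E v) <= K * gnorm g z (daddv_pi E F v).
Proof.
move=> EF [D [phi [DE DF lip DB ->]]] [s Ds <-] [t Dt <-] /=.
rewrite !exp_mapK; [|exact: DB..].
have FE : (F :&: E = 0)%VS by rewrite capvC.
have -> : s + phi s - (t + phi t) = (s - t) + (phi s - phi t).
  by rewrite opprD addrACA.
have stE : s - t \in E by rewrite rpredB ?DE.
have stF : phi s - phi t \in F by rewrite rpredB ?DF.
have pi0 (A B : {vspace 'rV[R]_n}) w :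
    (A :&: B = 0)%VS -> w \in B -> daddv_pi A B w = 0.
  move=> AB wB; have BA : (B :&: A = 0)%VS by rewrite capvC.
  have := daddv_pi_add AB (subvP (addvSr A B) _ wB).
  by rewrite (daddv_pi_id BA wB) => /(canRL (addrK _)); rewrite subrr.
rewrite !(linearD _ (s - t)) /= (daddv_pi_id EF stE) (daddv_pi_id FE stF).
by rewrite (pi0 _ _ _ EF stF) (pi0 _ _ _ FE stE) add0r addr0 lip.
Qed.

End Coordinates.

(** The metric core: ps, pu are the sizes of the components of p - x, which lies
    in the stable cone, and qs, qu those of the components of p - y, which lies in
    the unstable one.  The two triangle inequalities feed into each other, and
    the geometric series of factor K sums to 1 / (1 - K).  The statement treats
    the two directions alike, so that exchanging (ps, pu) with (qu, qs) bounds
    p - y. *)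
Lemma transverse_cone_bound (R : realFieldType) (K d ps pu qs qu : R) :
    0 <= K -> K < 1 -> 0 <= ps -> 0 <= qu ->
    pu <= K * ps -> qs <= K * qu -> ps <= qs + d -> qu <= pu + d ->
  Num.max ps pu <= (1 - K)^-1 * d.
Proof.
move=> K0 K1 ps0 qu0 hpu hqs hps hqu.
have K1' : 0 < 1 - K by lra.
have key : ps <= (1 - K)^-1 * d.
  (* ps <= K (K ps + d) + d, which is the claim multiplied by 1 + K *)
  rewrite mulrC ler_pdivlMr// -(ler_pM2r (_ : 0 < 1 + K)); last by lra.
  nra.
by rewrite ge_max key/=; nra.
Qed.

Theorem proposition5p3 (R : realType) (n : nat) (M : topologicalType)
  (X : smooth_manifold R n M) (g : riemannian_metric X)
  (M_hausdorff : hausdorff_space M) (M_compact : compact [set: M])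
  (* the diffeomorphism and the hyperbolic set, in an adapted metric *)
  (r : nat) (r_ge1 : (1 <= r)%N)
  (f finv : M -> M) (f_diffeo : Cr_diffeo X r f finv)
  (Lam : set M) (Es Eu : M -> {vspace 'rV[R]_n}) (lam : R)
  (Lam_hyp : hyperbolic g Lam f finv Es Eu 1 lam)
  (* the scales of the bracket *)
  (eps0 delta0 : R) (eps0_gt0 : 0 < eps0) (delta0_gt0 : 0 < delta0)
  (bracketP : forall x y, Lam x -> Lam y -> (rdist g x y < delta0%:E)%E ->
     exists2 p, Lam p & Wloc g f eps0 x `&` Wloc g finv eps0 y = [set p])
  (* the exponential coordinates *)
  (rho : R) (rho_gt0 : 0 < rho)
  (exp_inj : forall z, Lam z ->
     {in tball g z rho &, injective (exp_map g z)})
  (* the local manifolds are Lipschitz graphs in these coordinates *)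
  (K : R) (K_ge0 : 0 <= K) (K_lt : K < 2^-1)
  (graphs : forall x y z, Lam x -> Lam y -> Lam z ->
     (rdist g x y < delta0%:E)%E ->
     (rdist g z x < delta0%:E)%E -> (rdist g z y < delta0%:E)%E ->
     lipschitz_graph g rho z (Es z) (Eu z) K (Wloc g f eps0 x) /\
     lipschitz_graph g rho z (Eu z) (Es z) K (Wloc g finv eps0 y)) :
  let C1 := (1 - K)^-1 in
  forall x y z, Lam x -> Lam y -> Lam z ->
    (rdist g x y < delta0%:E)%E ->
    (rdist g z x < delta0%:E)%E -> (rdist g z y < delta0%:E)%E ->
    let d := coord_dist g rho Es Eu z in
    let p := bracket g f finv eps0 x y in
    d p x <= C1 * d x y /\ d p y <= C1 * d x y.
Proof.
move=> C1 x y z Lx Ly Lz xy zx zy d p.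
have [Gs Gu] := graphs x y z Lx Ly Lz xy zx zy.
have EsEu := hyp_cap Lam_hyp Lz.
have EuEs : (Eu z :&: Es z = 0)%VS by rewrite capvC.
have [px py] : (Wloc g f eps0 x `&` Wloc g finv eps0 y) p.
  have [q _ Wq] := bracketP x y Lx Ly xy.
  by apply: (xgetPex x); exists q; rewrite Wq.
have coneS := lipschitz_graph_log (exp_inj z Lz) EsEu Gs px
  (Wloc_refl g f x (ltW eps0_gt0)).
have coneU := lipschitz_graph_log (exp_inj z Lz) EuEs Gu py
  (Wloc_refl g finv y (ltW eps0_gt0)).
rewrite /d /coord_dist.
move: coneS coneU => /=; set P := log_map _ _ _ p.
set A := log_map _ _ _ x; set B := log_map _ _ _ y => coneS coneU.
have triS (E F : {vspace 'rV[R]_n}) : gnorm g z (daddv_pi E F (P - A)) <=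
    gnorm g z (daddv_pi E F (P - B)) + gnorm g z (daddv_pi E F (A - B)).
  rewrite -(gnormN g z (daddv_pi E F (A - B))) -linearN opprB /=.
  by rewrite -(subrKA B P (-A)) linearD /= ler_gnormD.
have triU (E F : {vspace 'rV[R]_n}) : gnorm g z (daddv_pi E F (P - B)) <=
    gnorm g z (daddv_pi E F (P - A)) + gnorm g z (daddv_pi E F (A - B)).
  by rewrite -(subrKA A P (-B)) linearD /= ler_gnormD.
have K1 : K < 1 by lra.
have dS := box_norm_projE g z (Es z) (Eu z) (A - B).
have dU := box_norm_projF g z (Es z) (Eu z) (A - B).
have hS := le_trans (triS (Es z) (Eu z)) (lerD (lexx _) dS).
have hU := le_trans (triU (Eu z) (Es z)) (lerD (lexx _) dU).
split.
  exact: (transverse_cone_bound K_ge0 K1 (gnorm_ge0 _ _ _) (gnorm_ge0 _ _ _)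
    coneS coneU hS hU).
rewrite {1}/box_norm maxC.
exact: (transverse_cone_bound K_ge0 K1 (gnorm_ge0 _ _ _) (gnorm_ge0 _ _ _)
    coneU coneS hU hS).
Qed.
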